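(* Consider a multi-urn search problem and a valid policy $\mathbf u$. The following hold for every stage $t$ (for which the probabilities involved are defined). 1. For any subset of urns $U\subseteq\mathcal V$ such that $u(t)\in U$, $$\mathbb P\Big(\bigcap_{i\in U}A_i\,\Big|\,\mathbf x(t)\Big)\ge\mathbb P\Big(\bigcap_{i\in U}A_i\,\Big|\,\mathbf x(t+1)\Big),$$ with equality holding only in cases in which $\mathbb P(A_{u(t)}\mid\mathbf x(t))=1$ or $\mathbb P(\bigcap_{i\in U}A_i\mid\mathbf x(t))=0$. 2. If urn $u(t)$ has more than one marble remaining at stage $t$, i.e. $N_{u(t)}-x_{u(t)}(t)>1$, then $$\mathbb P\big(w(\mathbf x(t),u(t))=1\big)\le\mathbb P\big(w(\mathbf x(t+1),u(t))=1\big),$$ with equality holding only when $\mathbb P(w(\mathbf x(t),u(t))=1)=0$.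
   Context: Multi-urn search problem. Let $\mathcal V$ be a finite nonempty set of urns. Urn $i\in\mathcal V$ contains $N_i\ge 1$ marbles ($N_i$ a known integer), at most one of which is red; all other marbles are blue. Let $A_i$ be the event that urn $i$ contains a red marble. For $U\subseteq\mathcal V$ put $\varphi_U=\mathbb P(\bigcap_{i\in U}A_i)$, with $\varphi_\emptyset=1$ and $\varphi_i=\varphi_{\{i\}}$; it is assumed that $\varphi_i>0$ for all $i$. The joint law of $(A_i)_{i\in\mathcal V}$ is arbitrary otherwise. Marbles are drawn from each urn in uniformly random order without replacement: given which urns contain a red marble, the position of the red marble in the draw order of each such urn $i$ is uniform on $\{1,\dots,N_i\}$, and these positions are independent across urns. Let $N=\sum_{i\in\mathcal V}N_i$. A valid policy is a sequence $\mathbf u=(u(0),\dots,u(N-1))$ of elements of $\mathcal V$ with $|\{t:u(t)=i\}|=N_i$ for every $i\in\mathcal V$; at stage $t=0,1,\dots$ a marble is drawn from urn $u(t)$ and discarded if blue, and the search stops when a red marble is drawn or all urns are empty. The state at stage $t$ is $\mathbf x(t)=(x_i(t))_{i\in\mathcal V}$ with $x_i(t)=|\{s<t:u(s)=i\}|$. Conditioning on $\mathbf x(t)$ means conditioning on the event that the first $t$ draws, from urns $u(0),\dots,u(t-1)$, all produced blue marbles; such conditional probabilities are considered only when this event has positive probability. For an urn $i$ with $x_i(t)<N_i$, $w(\mathbf x(t),i)\in\{0,1\}$ is the indicator that the next marble drawn from urn $i$ in state $\mathbf x(t)$ is red (whether or not $i=u(t)$), and its probability is taken conditionally on the first $t$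 draws being blue; thus $\mathbb P(w(\mathbf x(t),i)=1)=\frac{1}{N_i-x_i(t)}\mathbb P(A_i\mid\mathbf x(t))$. *)

(* Defs.v *)
From HB Require Import structures.
From mathcomp Require Import all_boot all_order all_algebra.
From mathcomp Require Import all_classical all_reals all_analysis.

Set Implicit Arguments.
Unset Strict Implicit.
Unset Printing Implicit Defensive.

Import Order.TTheory GRing.Theory Num.Theory.
Local Open Scope classical_set_scope.
Local Open Scope ring_scope.

(* Meaningful only when P C > 0 (it is 0 otherwise). *)
Definition cprob (R : realType) (d : measure_display) (T : measurableType d)
    (P : probability T R) (B C : set T) : R :=
  fine (P (B `&` C)) / fine (P C).

Definition all_of (V : finType) (T : Type) (A : V -> set T) (U : {set V}) :
    set T :=
  \bigcap_(i in [set` U]) A i.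

Definition exactly (V : finType) (T : Type) (A : V -> set T) (S : {set V}) :
    set T :=
  [set a | forall i, A i a <-> i \in S].

(* [red i] is the event that urn i contains a red marble and [pos i] is the
   rank, counted from 1, of that marble in the draw order of urn i.  The value
   of [pos i] off [red i] is junk: it is unconstrained and never used. *)
Record multi_urn (R : realType) (V : finType) (d : measure_display)
    (T : measurableType d) (P : probability T R) := MultiUrn {
  marbles : V -> nat;
  red : V -> set T;
  pos : V -> {RV P >-> nat};
  urns_nonempty : (0 < #|V|)%N;
  marbles_gt0 : forall i, (0 < marbles i)%N;
  red_measurable : forall i, measurable (red i);
  red_prob_gt0 : forall i, (0 < P (red i))%E;
  pos_uniform : forall (S : {set V}) (i : V) (k : nat),
    (0 < P (exactly red S))%E -> i \in S -> (1 <= k <= marbles i)%N ->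
    cprob P (pos i @^-1` [set k]) (exactly red S) = (marbles i)%:R^-1;
  pos_independent : forall (S U : {set V}) (B : V -> set nat),
    (0 < P (exactly red S))%E -> U \subset S ->
    cprob P (\bigcap_(i in [set` U]) (pos i @^-1` B i)) (exactly red S)
      = \prod_(i in U) cprob P (pos i @^-1` B i) (exactly red S)
}.

Section Search.
Context (R : realType) (V : finType) (d : measure_display)
  (T : measurableType d) (P : probability T R) (M : multi_urn V P).

Definition num_stages : nat := (\sum_(i : V) marbles M i)%N.

Definition valid_policy (u : num_stages.-tuple V) : Prop :=
  forall i, count_mem i u = marbles M i.

Definition state (u : num_stages.-tuple V) (t : nat) : V -> nat :=
  fun i => count_mem i (take t u).

Definition w (x : V -> nat) (i : V) : T -> R :=
  \1_(red M i `&` (pos M i @^-1` [set (x i).+1])).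

(* The conditioning event written "x(t)": the first t draws are all blue. *)
Definition all_blue (u : num_stages.-tuple V) (t : nat) : set T :=
  [set a | forall s : 'I_num_stages, (s < t)%N ->
     w (state u s) (tnth u s) a = 0].

End Search.

(* Main.v *)
Require Import Defs.
From HB Require Import structures.
From mathcomp Require Import all_boot all_order all_algebra.
From mathcomp Require Import all_classical all_reals all_analysis.
From mathcomp Require Import zify ring lra.
Set Implicit Arguments.
Unset Strict Implicit.
Unset Printing Implicit Defensive.
Import Order.TTheory GRing.Theory Num.Theory.
Local Open Scope classical_set_scope.
Local Open Scope ring_scope.

(** Fix a stage with state [x], let [v] be the urn drawn next and
    [r = marbles v - x v] the number of marbles left in it.  The history up to
    [x] only says that every red marble lies beyond the first [x i] ranks of
    its urn ([all_blueE]).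

    The heart of the matter is [next_red_prob]: on any event of the form
    `all urns of U are red' with [v \in U], and given the history, the next
    marble of [v] is red with probability [1 / r].  It is proved one profile
    (exact set [S] of red urns) at a time: by independence, the probability of
    a rectangle of ranks is a product over [S], and replacing `rank of [v]
    beyond [x v]' by `rank of [v] equal to [x v + 1]' changes one factor, from
    [r / marbles v] to [1 / marbles v].  The correlations between the urns
    cancel, since they only enter through the weights of the profiles.

    Write [b], [q], [D] for the probabilities of the history alone, together
    with `[v] is red', and together with `all of U is red'.  A blue draw from
    [v] turns [b] into [b - q / r], and multiplies [q] and [D] by [1 - 1 / r].
    Thus the posterior [D / b] loses exactly
    [D (b - q) / (r b (b - q / r))], which vanishes only if [D = 0] or [q = b].
    For the detection probability, the joint probability
    [q (1 - 1 / r) / (r - 1) = q / r] of a blue history and a red next marble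
    does not move, while the conditioning event can only shrink, and
    it keeps its probability only if [q = 0]. *)

(** * Arithmetic of the two comparisons *)

Section Arithmetic.
Context (F : realFieldType).
Implicit Types b q D r : F.

(** With [b], [q], [D] the probabilities of the history, of the history with a
    red marble in the drawn urn, and of the history with all of U red, this
    compares the posteriors of U after and before a blue draw. *)
Lemma posterior_decrease b q D r : 0 < b -> q <= b -> 1 <= r ->
    0 < b - q / r -> 0 <= D ->
  D * (1 - r^-1) / (b - q / r) <= D / b /\
  (D / b = D * (1 - r^-1) / (b - q / r) -> q / b = 1 \/ D / b = 0).
Proof.
move=> b0 qb r1 b1 D0; have r0 : 0 < r by lra.
have rn0 : r != 0 by rewrite gt_eqF.
have bn0 : b != 0 by rewrite gt_eqF.
have gapE : D / b - D * (1 - r^-1) / (b - q / r) =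
    D * (b - q) / (r * b * (b - q / r)).
  have brq : b * r - q != 0.
    rewrite (_ : b * r - q = (b - q / r) * r); last by field.
    by rewrite mulf_neq0 // gt_eqF.
  by field; rewrite brq rn0 bn0.
have den0 : 0 < r * b * (b - q / r) by apply: mulr_gt0 => //; exact: mulr_gt0.
split.
  rewrite -subr_ge0 gapE divr_ge0 ?(ltW den0)//.
  by rewrite mulr_ge0 ?subr_ge0.
move/eqP; rewrite -subr_eq0 gapE mulf_eq0 invr_eq0 (gt_eqF den0) orbF.
rewrite mulf_eq0 subr_eq0 => /orP[/eqP->|/eqP<-]; first by right; rewrite mul0r.
by left; rewrite divff.
Qed.

(** Both joint probabilities are [q / r]; only the conditioning events differ,
    and [b - q / r = b] exactly when [q = 0]. *)
Lemma detection_increase b q r : 0 < b -> 0 <= q -> 1 < r -> 0 < b - q / r ->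
  q / r / b <= q * (1 - r^-1) / (r - 1) / (b - q / r) /\
  (q / r / b = q * (1 - r^-1) / (r - 1) / (b - q / r) -> q / r / b = 0).
Proof.
move=> b0 q0 r1 b1; have r0 : 0 < r by lra.
have qr0 : 0 <= q / r by rewrite divr_ge0// ltW.
have -> : q * (1 - r^-1) / (r - 1) = q / r.
  by field; apply/andP; split; rewrite gt_eqF//; lra.
split; first by rewrite ler_wpM2l// lef_pV2 ?posrE//; lra.
have [->|qrn0] := eqVneq (q / r) 0; first by rewrite mul0r.
move=> /(mulfI qrn0) /invr_inj e.
by move: qrn0; rewrite (_ : q / r = 0) ?eqxx//; lra.
Qed.

End Arithmetic.

(** * Real-valued probabilities *)

Section RealProbability.
Context (R : realType) (d : measure_display) (T : measurableType d)
  (P : probability T R).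

Lemma prob_ge0 (A : set T) : 0 <= fine (P A).
Proof. by apply: fine_ge0; exact: measure_ge0. Qed.

Lemma prob_gt0 (A : set T) : measurable A -> (0 < P A)%E -> 0 < fine (P A).
Proof. by move=> mA; rewrite -lte_fin fineK// fin_num_measure. Qed.

Lemma le_prob (A B : set T) : measurable A -> measurable B -> A `<=` B ->
  fine (P A) <= fine (P B).
Proof.
move=> mA mB AB; apply: fine_le; rewrite ?fin_num_measure//.
by apply: le_measure; rewrite ?inE.
Qed.

Lemma prob_setD (A B : set T) : measurable A -> measurable B ->
  fine (P (A `\` B)) = fine (P A) - fine (P (A `&` B)).
Proof.
move=> mA mB; rewrite (measureDI P mA mB) fineD ?fin_num_measure//.
- by rewrite addrK.
- exact: measurableD.
- exact: measurableI.
Qed.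

Lemma prob_partition (I : finType) (F : I -> set T) (A : set T) :
  (forall i, measurable (F i)) -> trivIset setT F -> \bigcup_i F i = setT ->
  measurable A -> fine (P A) = \sum_i fine (P (A `&` F i)).
Proof.
move=> mF tF cF mA.
have mAF i : measurable (A `&` F i) by exact: measurableI.
apply: EFin_inj; rewrite -sumEFin fineK ?fin_num_measure//.
under eq_bigr do rewrite fineK ?fin_num_measure//.
rewrite -{1}(setIT A) -cF setI_bigcupr measure_fin_bigcup//; last 2 first.
- exact: finite_finset.
- by apply: trivIset_setIl.
rewrite (_ : [set: I] = [set` index_enum I]).
  by rewrite -fsbig_seq// index_enum_uniq.
by apply/seteqP; split => i //= _; rewrite mem_index_enum.
Qed.

End RealProbability.

(** * The law of the ranks in a given state *)

Section Search.
Context (R : realType) (V : finType) (d : measure_display)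
  (T : measurableType d) (P : probability T R) (M : multi_urn V P).
Implicit Types (x : V -> nat) (v i : V) (S U : {set V}).

(** Ranks start at 1, and the value 0 is kept so that [undrawn 0] is the full
    set: the empty history is then the sure event. *)
Definition undrawn (n : nat) : set nat := [set k | ~~ (0 < k <= n)%N].

Definition blue_up_to x : set T :=
  [set a | forall i, red M i a -> undrawn (x i) (pos M i a)].

Definition next_red x v : set T :=
  red M v `&` pos M v @^-1` [set (x v).+1].

Definition draw x v : V -> nat := fun i => (x i + (v == i))%N.

Lemma undrawnS n : undrawn n.+1 = undrawn n `\` [set n.+1].
Proof.
apply/seteqP; rewrite /undrawn; split => [k /= h|k /= [h1 h2]].
  by split; [|move=> kn; move: h; rewrite kn]; lia.
by apply/negP => h; apply: h2; lia.
Qed.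

Lemma measurable_pos i (B : set nat) : measurable (pos M i @^-1` B).
Proof. exact: measurable_funPTI. Qed.

Lemma measurable_all_of U : measurable (all_of (red M) U).
Proof.
apply: fin_bigcap_measurable; first exact: finite_finset.
by move=> i _; exact: red_measurable.
Qed.

Lemma exactlyE S :
  exactly (red M) S = \bigcap_i (if i \in S then red M i else ~` red M i).
Proof.
apply/seteqP; split => a /= h i.
  by move=> _; have := h i; case: ifP => iS [h1 h2] /=; [apply: h2|move/h1].
have := h i Logic.I; case: ifP => iS /= h'; split => //.
Qed.

Lemma measurable_exactly S : measurable (exactly (red M) S).
Proof.
rewrite exactlyE; apply: fin_bigcap_measurable; first exact: finite_finset.
move=> i _; case: ifP => _; [|apply: measurableC]; exact: red_measurable.
Qed.

Lemma measurable_next_red x v : measurable (next_red x v).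
Proof. by apply: measurableI; [exact: red_measurable|exact: measurable_pos]. Qed.

Lemma blue_up_toE x :
  blue_up_to x = \bigcap_i (~` (red M i `\` pos M i @^-1` undrawn (x i))).
Proof.
apply/seteqP; split => a /= h i.
  by move=> _ /= [ri]; apply; exact: h.
by move=> ri; have := h i Logic.I => /= /not_andP[//|/contrapT].
Qed.

Lemma measurable_blue_up_to x : measurable (blue_up_to x).
Proof.
rewrite blue_up_toE; apply: fin_bigcap_measurable; first exact: finite_finset.
move=> i _; apply/measurableC/measurableD; first exact: red_measurable.
exact: measurable_pos.
Qed.

(** The profiles partition the sample space; this reduces every statement
    about the arbitrary joint law of the [red i] to a fixed profile, where the
    ranks are uniform and independent. *)
Lemma exactly_partition A : measurable A ->
  fine (P A) = \sum_S fine (P (A `&` exactly (red M) S)).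
Proof.
apply: prob_partition.
- exact: measurable_exactly.
- apply/trivIsetP => S S' _ _ /eqP SS'.
  apply/seteqP; split => // a [/= h h']; apply: SS'; apply/setP => i.
  by apply/idP/idP => [/h/h'|/h'/h].
- apply/seteqP; split => // a _; exists [set i | `[< red M i a >]]%SET => //= i.
  by rewrite inE; split => /asboolP.
Qed.

(** Induction on [n]: each further draw removes one rank, of probability
    [1 / marbles i]. *)
Lemma pos_undrawn_prob S i n : (0 < P (exactly (red M) S))%E -> i \in S ->
  (n <= marbles M i)%N ->
  cprob P (pos M i @^-1` undrawn n) (exactly (red M) S)
    = (marbles M i - n)%:R / (marbles M i)%:R.
Proof.
move=> S0 iS.
have mE := measurable_exactly S.
have E0 := prob_gt0 mE S0.
have N0 : (marbles M i)%:R != 0 :> R by rewrite pnatr_eq0 -lt0n marbles_gt0.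
elim: n => [_|n IH nN].
  rewrite subn0 divff// /cprob (_ : _ @^-1` _ = setT) ?setTI ?divff ?gt_eqF//.
  by apply/seteqP; split => // a _ /=; rewrite /undrawn /=; lia.
rewrite undrawnS /cprob.
rewrite -[_ @^-1` (_ `\` _)]/(pos M i @^-1` undrawn n `\`
  pos M i @^-1` [set n.+1]).
rewrite setIC setIDA prob_setD; last 2 first.
- by apply: measurableI => //; exact: measurable_pos.
- exact: measurable_pos.
rewrite -setIA -preimage_setI.
rewrite (_ : undrawn n `&` [set n.+1] = [set n.+1]); last first.
  by apply/seteqP; split => [k []//|k /= ->]; split => //; rewrite /undrawn /=; lia.
have := pos_uniform (k := n.+1) S0 iS; have := IH (ltnW nN).
rewrite /cprob mulrBl ![exactly _ _ `&` _]setIC => -> -> //.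
rewrite -[X in _ - X]mul1r -mulrBl; congr (_ / _).
by rewrite subnS -[in LHS](prednK (n := _ - n)) ?subn_gt0// -natr1 addrK.
Qed.

(** In a fixed profile the rectangles `all ranks undrawn' and `same, but rank
    of [v] next' have product probabilities that differ only in the factor of
    [v]; the other factors cancel without having to be computed. *)
Lemma next_pos_uniform S v x : v \in S -> (x v < marbles M v)%N ->
  fine (P (pos M v @^-1` [set (x v).+1] `&` (blue_up_to x `&` exactly (red M) S)))
  = fine (P (blue_up_to x `&` exactly (red M) S)) / (marbles M v - x v)%:R.
Proof.
move=> vS xv; have mE := measurable_exactly S.
have mB := measurable_blue_up_to x.
have [S0|S0] := ltP 0%E (P (exactly (red M) S)); last first.
  (* a null profile carries no hypothesis on the ranks; both sides vanish *)
  have null A : measurable A -> fine (P (A `&` exactly (red M) S)) = 0.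
    move=> mA; apply/le_anti; rewrite prob_ge0 andbT.
    apply: le_trans (le_prob P _ mE (@subIsetr _ A _)) _.
      exact: measurableI.
    exact: fine_le0.
  rewrite setIA !null ?mul0r//.
  by apply: measurableI => //; exact: measurable_pos.
have E0 := prob_gt0 mE S0.
(* [C false] is the rectangle of undrawn ranks; [C true] pins the rank of [v] *)
pose C (b : bool) i : set nat :=
  if b && (i == v) then [set (x v).+1] else undrawn (x i).
pose tail := \prod_(i in S | i != v)
  cprob P (pos M i @^-1` undrawn (x i)) (exactly (red M) S).
have CE b : fine (P (\bigcap_(i in [set` S]) (pos M i @^-1` C b i)
      `&` exactly (red M) S)) / fine (P (exactly (red M) S)) =
    cprob P (pos M v @^-1` C b v) (exactly (red M) S) * tail.
  rewrite -/(cprob P _ _) (pos_independent (C b) S0 (subxx S)) (bigD1 v)//=.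
  by congr (_ * _); apply: eq_bigr => i /andP[_ /negbTE iv]; rewrite /C iv andbF.
have CF : blue_up_to x `&` exactly (red M) S =
    \bigcap_(i in [set` S]) (pos M i @^-1` C false i) `&` exactly (red M) S.
  apply/seteqP; split => a [/= h hS]; split => // i.
    by move=> /= /hS; exact: h.
  by move=> /hS; exact: h.
have CT : pos M v @^-1` [set (x v).+1] `&` (blue_up_to x `&` exactly (red M) S) =
    \bigcap_(i in [set` S]) (pos M i @^-1` C true i) `&` exactly (red M) S.
  apply/seteqP; split => [a [/= hv [h hS]]|a [/= h hS]].
    by split => // i /= /hS; rewrite /C /=; case: eqP => [->//|_]; exact: h.
  have hv : pos M v a = (x v).+1 by have := h v vS; rewrite /C /= eqxx.
  split => //; split => // i /hS iS; have := h i iS; rewrite /C /=.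
  by case: eqP => // ->; rewrite hv /undrawn /=; lia.
have N0 : (marbles M v)%:R != 0 :> R by rewrite pnatr_eq0 -lt0n marbles_gt0.
have r0 : (marbles M v - x v)%:R != 0 :> R by rewrite pnatr_eq0 -lt0n subn_gt0.
apply: (mulIf (x := (fine (P (exactly (red M) S)))^-1)).
  by rewrite invr_eq0 gt_eqF.
rewrite mulrAC CT CF !CE /C /= eqxx.
rewrite pos_undrawn_prob ?(ltnW xv)// pos_uniform//.
by field; rewrite N0 r0.
Qed.

(** The weights of the profiles inside [all_of U] are arbitrary, but the ratio
    [1 / r] is the same in each of them as [v \in U], so it survives summation.
    *)
Lemma next_red_prob U v x : v \in U -> (x v < marbles M v)%N ->
  fine (P (all_of (red M) U `&` (blue_up_to x `&` next_red x v)))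
  = fine (P (all_of (red M) U `&` blue_up_to x)) / (marbles M v - x v)%:R.
Proof.
move=> vU xv; have mB := measurable_blue_up_to x.
have mU := measurable_all_of U; have mn := measurable_next_red x v.
rewrite exactly_partition; last by do 2 apply: measurableI => //.
rewrite [in RHS]exactly_partition; last exact: measurableI.
rewrite mulr_suml; apply: eq_bigr => S _.
have [US|/subsetPn[i iU iS]] := boolP (U \subset S); last first.
  have null A : all_of (red M) U `&` A `&` exactly (red M) S = set0.
    apply/seteqP; split => // a [[h _]] /(_ i)[hS _].
    by move: iS; rewrite hS//; exact: h.
  by rewrite !null measure0 mul0r.
have vS := fintype.subsetP US v vU.
have all_ofS A : all_of (red M) U `&` A `&` exactly (red M) S =
    A `&` exactly (red M) S.
  apply/seteqP; split => [a [[_ ?] ?]//|a [ha hS]]; split => //; split => //.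
  by move=> i /= iU; apply/hS; exact: (fintype.subsetP US).
rewrite !all_ofS -next_pos_uniform//; congr (fine (P _)).
apply/seteqP; split => [a [[? [? ?]] ?]//|a [? [? hS]]].
by do 2 split => //; split => //; apply/hS.
Qed.

Lemma blue_up_to_draw x v :
  blue_up_to (draw x v) = blue_up_to x `\` next_red x v.
Proof.
apply/seteqP; split => [a h|a [h hv] i].
  split=> [i /h|[/h hv /= e]]; move: hv || idtac; rewrite /draw.
    by rewrite /undrawn /=; case: (v == i); lia.
  by rewrite /undrawn /= eqxx e; lia.
rewrite /draw; case: eqP => [<-|_] ri; last by rewrite addn0; exact: h.
rewrite addn1 undrawnS; split; first exact: h.
by move=> e; apply: hv.
Qed.

Lemma draw_prob U v x : v \in U -> (x v < marbles M v)%N ->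
  fine (P (all_of (red M) U `&` blue_up_to (draw x v)))
  = fine (P (all_of (red M) U `&` blue_up_to x))
      * (1 - (marbles M v - x v)%:R^-1).
Proof.
move=> vU xv; rewrite blue_up_to_draw setIDA prob_setD.
- by rewrite -setIA next_red_prob// mulrBr mulr1.
- by apply: measurableI; [exact: measurable_all_of|exact: measurable_blue_up_to].
- exact: measurable_next_red.
Qed.

Lemma all_of1 v : all_of (red M) [set v]%SET = red M v.
Proof.
apply/seteqP; split => [a /(_ v)|a h i /=]; first by apply; rewrite /= inE.
by rewrite inE => /eqP->.
Qed.

Lemma wE x v : w M x v @^-1` [set 1] = next_red x v.
Proof.
apply/seteqP; split => a /=; rewrite /w indicE.
  by case: (boolP (a \in _)) => [/set_mem//|_] /esym/eqP; rewrite oner_eq0.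
by move=> h; rewrite mem_set.
Qed.

(** * Histories of a policy as states *)

Lemma stateS (u : (num_stages M).-tuple V) (t : 'I_(num_stages M)) :
  state u t.+1 = draw (state u t) (tnth u t).
Proof.
apply/funext => i; rewrite /state /draw.
rewrite (take_nth (tnth u t)) ?size_tuple// -cats1 count_cat /= addn0.
by rewrite -tnth_nth.
Qed.

Lemma all_blueS (u : (num_stages M).-tuple V) (t : 'I_(num_stages M)) :
  all_blue u t.+1 = all_blue u t `\` next_red (state u t) (tnth u t).
Proof.
have w0 x v a : w M x v a = 0 <-> ~ next_red x v a.
  rewrite /w indicE; case: (boolP (a \in _)) => [/set_mem h|/negP h].
    by split=> [/eqP|//]; rewrite oner_eq0.
  by split=> // _; apply: contra_not h => h; exact: mem_set.
apply/seteqP; split => [a h|a [h ht] s].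
  split=> [s st|]; first by apply: h; rewrite ltnS ltnW.
  by apply/w0; apply: h.
rewrite ltnS leq_eqVlt => /orP[/eqP/val_inj->|]; last exact: h.
exact/w0.
Qed.

(** The order of the draws is forgotten: a blue history depends only on how
    many marbles left each urn. *)
Lemma all_blueE (u : (num_stages M).-tuple V) t : (t <= num_stages M)%N ->
  all_blue u t = blue_up_to (state u t).
Proof.
elim: t => [_|t IH tN].
  apply/seteqP; split => // a _ i _.
  by rewrite /state take0 /undrawn /=; lia.
rewrite (all_blueS u (Ordinal tN)) (stateS u (Ordinal tN)) /=.
by rewrite IH ?(ltnW tN)// blue_up_to_draw.
Qed.

(** By validity, the draw at stage [t] is itself one of the [marbles] draws
    from its urn, so that urn is not exhausted just before. *)
Lemma state_lt_marbles (u : (num_stages M).-tuple V) (t : 'I_(num_stages M)) :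
  valid_policy u -> (state u t (tnth u t) < marbles M (tnth u t))%N.
Proof.
move=> hu; rewrite -hu.
rewrite -[in ltnRHS](cat_take_drop t.+1 (u : seq V)) count_cat ltn_addr//.
by rewrite -/(state u t.+1 _) stateS /draw eqxx addn1.
Qed.

End Search.

Theorem theorem7 (R : realType) (V : finType) (d : measure_display)
    (T : measurableType d) (P : probability T R) (M : multi_urn V P)
    (u : (num_stages M).-tuple V) (hu : valid_policy u) (t : 'I_(num_stages M))
    (ht : (0 < P (all_blue u t))%E) (ht1 : (0 < P (all_blue u t.+1))%E) :
  (forall U : {set V}, tnth u t \in U ->
     cprob P (all_of (red M) U) (all_blue u t.+1)
       <= cprob P (all_of (red M) U) (all_blue u t)
     /\ (cprob P (all_of (red M) U) (all_blue u t)
           = cprob P (all_of (red M) U) (all_blue u t.+1) ->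
         cprob P (red M (tnth u t)) (all_blue u t) = 1
         \/ cprob P (all_of (red M) U) (all_blue u t) = 0))
  /\
  ((1 < marbles M (tnth u t) - state u t (tnth u t))%N ->
     cprob P (w M (state u t) (tnth u t) @^-1` [set 1]) (all_blue u t)
       <= cprob P (w M (state u t.+1) (tnth u t) @^-1` [set 1])
            (all_blue u t.+1)
     /\ (cprob P (w M (state u t) (tnth u t) @^-1` [set 1]) (all_blue u t)
           = cprob P (w M (state u t.+1) (tnth u t) @^-1` [set 1])
               (all_blue u t.+1) ->
         cprob P (w M (state u t) (tnth u t) @^-1` [set 1]) (all_blue u t)
           = 0)).
Proof.
have := state_lt_marbles t hu.
move: ht ht1; rewrite !wE !all_blueE ?(ltnW (ltn_ord t))// stateS.
set x := state u t; set v := tnth u t => ht ht1 xv.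
have mB y := measurable_blue_up_to M y.
have b0 := prob_gt0 (mB _) ht; have b1 := prob_gt0 (mB _) ht1.
(* stated for every state [y], as it is needed before and after the draw *)
have redb y : (y v < marbles M v)%N ->
    fine (P (next_red M y v `&` blue_up_to M y)) =
    fine (P (red M v `&` blue_up_to M y)) / (marbles M v - y v)%:R.
  move=> yv; rewrite -(all_of1 M v) -next_red_prob ?inE// all_of1.
  congr (fine (P _)); rewrite /next_red.
  by apply/seteqP; split => [a [[? ?] ?]|a [? [? [? ?]]]].
have b'E : fine (P (blue_up_to M (draw x v))) = fine (P (blue_up_to M x)) -
    fine (P (red M v `&` blue_up_to M x)) / (marbles M v - x v)%:R.
  rewrite blue_up_to_draw prob_setD//; last exact: measurable_next_red.
  by rewrite setIC redb.
have redb' : fine (P (red M v `&` blue_up_to M (draw x v))) =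
    fine (P (red M v `&` blue_up_to M x)) * (1 - (marbles M v - x v)%:R^-1).
  by rewrite -!all_of1 draw_prob// inE.
have qb : fine (P (red M v `&` blue_up_to M x)) <= fine (P (blue_up_to M x)).
  apply: le_prob => //; apply: measurableI => //; exact: red_measurable.
have q0 := prob_ge0 P (red M v `&` blue_up_to M x).
have r1 : 1 <= (marbles M v - x v)%:R :> R by rewrite ler1n subn_gt0.
split=> [U vU|r2].
  have dE := draw_prob vU xv.
  have := prob_ge0 P (all_of (red M) U `&` blue_up_to M x).
  rewrite /cprob dE; move: b1; rewrite b'E => b1 D0.
  exact: posterior_decrease.
rewrite /cprob !redb//; last by rewrite /draw eqxx; lia.
have -> : (marbles M v - draw x v v)%:R = (marbles M v - x v)%:R - 1 :> R.
  by rewrite /draw eqxx addn1 subnS -subn1 natrB// subn_gt0.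
rewrite redb'; move: b1; rewrite b'E => b1.
by apply: detection_increase; rewrite ?ltr1n.
Qed.
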